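(* Let $\mathbf{v}^*=(\mathbf{u}^*,\mathbf{x}^*,\mathbf{w}^* )$ be an S-stationary point of the optimal control problem (P) stated in the context, and let the M-multiplier strong second-order sufficient condition (M-SSOSC) hold at $\mathbf{v}^*$. Then $\mathbf{v}^*$ is an isolated local minimizer, i.e. there exists $\epsilon>0$ such that for every $\mathbf{v}=(\mathbf{u},\mathbf{x},\mathbf{w})\neq\mathbf{v}^*$ feasible for (P) with $\|\mathbf{v}-\mathbf{v}^*\|\le\epsilon$, $$\ell_N(x_N^* )+\sum_{k=0}^{N-1}\ell_k(x_k^*,u_k^* )<\ell_N(x_N)+\sum_{k=0}^{N-1}\ell_k(x_k,u_k).$$ Furthermore, $\mathbf{w}^*$ is the only trajectory of complementarity variables solving the complementarity constraints of (P) for the fixed $\mathbf{u}^*$ and $\mathbf{x}^*$.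
   Context: Notation: $\mathbb{N}_n=\{1,\dots,n\}$; superscripts in square brackets denote components of vectors or rows/entries of matrices; vector inequalities are componentwise; $a\perp b$ means $a^\top b=0$. LC model: state $x\in\mathbb{R}^{n_x}$, input $u\in\mathbb{R}^{n_u}$, complementarity variable $w\in\mathbb{R}^{n_w}$, $$x^+ = Ax+B_uu+B_ww+c,\qquad 0\le E_ww+E_xx+E_uu+e\ \perp\ w\ge 0,$$ with real matrices and vectors of compatible dimensions. Standing assumptions on the LC model. Well-posedness: for every fixed $(x,u)$, all $w$ solving the complementarity problem give the same $x^+$. Rank-one block structure: there exist $n_b\in\mathbb{N}$ and a partition of $\mathbb{N}_{n_w}$ into $n_b$ blocks of sizes $n_{w_1},\dots,n_{w_{n_b}}$ such that (after a corresponding simultaneous reordering of components of $w$ and rows) the complementarity problem decomposes into independent sub-problems $0\le M_iw_i+C_ix+D_iu+e_i\perp w_i\ge0$, $i\in\mathbb{N}_{n_b}$, with $M_i=m_im_i^\top$, $m_i\in\mathbb{R}^{n_{w_i}}$ having no zero component. Nontrivial sub-problem solutions: for every $x,u$ and every $i\in\mathbb{N}_{n_b}$ there is $j\in\mathbb{N}_{n_{w_i}}$ with $C_i^{[j,:]}x+D_i^{[j,:]}u+e_i^{[j]}<0$. Optimal control problem (P): for a horizon $N\ge1$ and a given initial state $\bar x$, minimize over $\mathbf{u}=(u_0,\dots,u_{N-1})$, $\mathbf{x}=(x_0,\dots,x_N)$, $\mathbf{w}=(w_0,\dots,w_{N-1})$ $$J(\mathbf{v})=\ell_N(x_N)+\sum_{k=0}^{N-1}\ell_k(x_k,u_k)$$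 subject to $x_0=\bar x$ and, for $k=0,\dots,N-1$, $x_{k+1}=Ax_k+B_uu_k+B_ww_k+c$ and $0\le r_k\perp w_k\ge0$, where $r_k:=E_ww_k+E_xx_k+E_uu_k+e$. The costs $\ell_k,\ell_N$ are real-valued, convex and twice continuously differentiable. Index sets: for feasible $\mathbf{v}^*$ let $r_k^*$ be the value of $r_k$ at $\mathbf{v}^*$ and $\alpha_k=\{i: r_k^{*[i]}=0,\ w_k^{*[i]}>0\}$, $\beta_k=\{i: r_k^{*[i]}=0,\ w_k^{*[i]}=0\}$, $\gamma_k=\{i: r_k^{*[i]}>0,\ w_k^{*[i]}=0\}$. S-stationarity: $\mathbf{v}^*$ is S-stationary if there exist $\mu_k\in\mathbb{R}^{n_x}$, $\nu_k,\lambda_k\in\mathbb{R}^{n_w}$, $k=0,\dots,N-1$, with $$\nabla\ell_N(x_N^* )+\mu_{N-1}=0,$$ $$\nabla_{x}\ell_k(x_k^*,u_k^* )+\mu_{k-1}-A^\top\mu_k-E_x^\top\nu_k=0\quad(k=1,\dots,N-1),$$ $$\nabla_{u}\ell_k(x_k^*,u_k^* )-B_u^\top\mu_k-E_u^\top\nu_k=0,\qquad -B_w^\top\mu_k-E_w^\top\nu_k-\lambda_k=0\quad(k=0,\dots,N-1),$$ and for every $k$: $\lambda_k^{[i]}=0$ for $i\in\alpha_k$; $\nu_k^{[i]}=0$ for $i\in\gamma_k$; $\nu_k^{[i]}\ge0$ and $\lambda_k^{[i]}\ge0$ for $i\in\beta_k$. M-SSOSC: the MPEC critical cone $\mathcal{C}_{MPEC}(\mathbf{v}^*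 )$ is the set of directions $d=(d_{u_0},\dots,d_{u_{N-1}},d_{x_0},\dots,d_{x_N},d_{w_0},\dots,d_{w_{N-1}})$ such that $d_{x_0}=0$; $d_{x_{k+1}}=Ad_{x_k}+B_ud_{u_k}+B_wd_{w_k}$ for all $k$; with $s_k:=E_wd_{w_k}+E_xd_{x_k}+E_ud_{u_k}$, $s_k^{[i]}=0$ for $i\in\alpha_k$, $d_{w_k}^{[i]}=0$ for $i\in\gamma_k$, and $s_k^{[i]}\ge0$, $d_{w_k}^{[i]}\ge0$, $s_k^{[i]}d_{w_k}^{[i]}=0$ for $i\in\beta_k$; and $\nabla J(\mathbf{v}^* )^\top d\le0$. M-SSOSC holds at $\mathbf{v}^*$ if $d^\top\nabla^2J(\mathbf{v}^* )d>0$ for all $d\in\mathcal{C}_{MPEC}(\mathbf{v}^* )\setminus\{0\}$. *)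

(* Defs.v *)
From HB Require Import structures.
From mathcomp Require Import all_boot all_order all_algebra.
From mathcomp Require Import all_classical all_reals all_analysis.
Set Implicit Arguments.
Unset Strict Implicit.
Unset Printing Implicit Defensive.
Import Order.TTheory GRing.Theory Num.Theory.
Import numFieldNormedType.Exports.
Local Open Scope classical_set_scope.
Local Open Scope ring_scope.

Section Calculus.
Context {R : realType}.

Definition grad (n : nat) (f : 'cV[R]_n -> R) (x : 'cV[R]_n) : 'cV[R]_n :=
  \col_i 'D_(delta_mx i 0) f x.

Definition hess (n : nat) (f : 'cV[R]_n -> R) (x : 'cV[R]_n) : 'M[R]_n :=
  \matrix_(i, j) 'D_(delta_mx i 0) (fun z => 'D_(delta_mx j 0) f z) x.

Definition C2 (n : nat) (f : 'cV[R]_n -> R) : Prop :=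
  [/\ forall x, differentiable f x,
      forall x, differentiable (grad f) x
    & continuous (hess f)].

Definition nonneg_vec (n : nat) (a : 'cV[R]_n) : Prop := forall i, 0 <= a i 0.

Definition perp (n : nat) (a b : 'cV[R]_n) : Prop := a^T *m b = 0.

Definition complementary (n : nat) (a b : 'cV[R]_n) : Prop :=
  [/\ nonneg_vec a, perp a b & nonneg_vec b].

End Calculus.

Record lcmodel (R : realType) (nx nu nw : nat) := LCModel {
  Am : 'M[R]_nx;
  Bu : 'M[R]_(nx, nu);
  Bw : 'M[R]_(nx, nw);
  cv : 'cV[R]_nx;
  Ew : 'M[R]_nw;
  Ex : 'M[R]_(nw, nx);
  Eu : 'M[R]_(nw, nu);
  ev : 'cV[R]_nw }.

(* The blocks have sizes [bsize i]; [reord] maps a position in the block-wise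
   ordering to the original index in 'I_nw. *)
Record block_partition (nw : nat) := BlockPartition {
  nblk : nat;
  bsize : 'I_nblk -> nat;
  reord : 'I_(\sum_(i < nblk) bsize i) -> 'I_nw;
  reord_bij : bijective reord }.

Section Model.
Context {R : realType} {nx nu nw : nat}.
Variable S : lcmodel R nx nu nw.

Definition lc_next (x : 'cV[R]_nx) (u : 'cV[R]_nu) (w : 'cV[R]_nw) : 'cV[R]_nx :=
  Am S *m x + Bu S *m u + Bw S *m w + cv S.

Definition lc_resid (x : 'cV[R]_nx) (u : 'cV[R]_nu) (w : 'cV[R]_nw) : 'cV[R]_nw :=
  Ew S *m w + Ex S *m x + Eu S *m u + ev S.

Definition lcp_sol x u w : Prop := complementary (lc_resid x u w) w.

Definition well_posed : Prop := forall x u w1 w2,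
  lcp_sol x u w1 -> lcp_sol x u w2 -> lc_next x u w1 = lc_next x u w2.

Definition rank_one_blocks (bp : block_partition nw) : Prop :=
  exists m : forall i : 'I_(nblk bp), 'cV[R]_(bsize i),
    (forall i j, m i j 0 != 0) /\
    mxsub (@reord nw bp) (@reord nw bp) (Ew S) = \mxdiag_i (m i *m (m i)^T).

Definition block_rows (bp : block_partition nw) (p : nat) (A : 'M[R]_(nw, p))
    (i : 'I_(nblk bp)) : 'M[R]_(bsize i, p) :=
  submxcol (rowsub (@reord nw bp) A) i.

Definition nontrivial_subsolutions (bp : block_partition nw) : Prop :=
  forall x u (i : 'I_(nblk bp)), exists j,
    (block_rows (Ex S) i *m x + block_rows (Eu S) i *m u + block_rows (ev S) i)
      j 0 < 0.

Definition standing_assumptions : Prop :=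
  well_posed /\
  exists bp, rank_one_blocks bp /\ nontrivial_subsolutions bp.

End Model.

(* A trajectory is one stacked column vector (u, x, w), so that the gradient
   and the Hessian of the cost are an actual vector and matrix. *)
Section Trajectories.
Context {R : realType} {nx nu nw N : nat}.

Definition traj : Type :=
  'cV[R]_(\sum_(k < N) nu + \sum_(k < N.+1) nx + \sum_(k < N) nw).

Definition uk (v : traj) (k : 'I_N) : 'cV[R]_nu := submxcol (usubmx (usubmx v)) k.
Definition xk (v : traj) (k : 'I_N.+1) : 'cV[R]_nx := submxcol (dsubmx (usubmx v)) k.
Definition wk (v : traj) (k : 'I_N) : 'cV[R]_nw := submxcol (dsubmx v) k.

End Trajectories.
Arguments traj : clear implicits.

(* For k : 'I_N, [cur k] and [nxt k] are the indices k and k + 1 in 'I_N.+1. *)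
Notation cur k := (widen_ord (leqnSn _) k).
Notation nxt k := (lift ord0 k).

Record ocp (R : realType) (nx nu nw N : nat) := OCP {
  model : lcmodel R nx nu nw;
  xinit : 'cV[R]_nx;
  stage : 'I_N -> 'cV[R]_nx -> 'cV[R]_nu -> R;
  terminal : 'cV[R]_nx -> R }.

Section OCP.
Context {R : realType} {nx nu nw N : nat}.
Variable P : ocp R nx nu nw N.
Local Notation S := (model P).
Local Notation traj := (traj R nx nu nw N).

(* Regularity of the stage costs is joint in (x, u). *)
Definition stage_joint (k : 'I_N) (z : 'cV[R]_(nx + nu)) : R :=
  stage P k (usubmx z) (dsubmx z).

Definition convex_costs : Prop :=
  convex_function setT (terminal P) /\
  forall k, convex_function setT (stage_joint k).

Definition C2_costs : Prop :=
  C2 (terminal P) /\ forall k, C2 (stage_joint k).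

Definition cost (v : traj) : R :=
  terminal P (xk v ord_max) + \sum_(k < N) stage P k (xk v (cur k)) (uk v k).

Definition rk (v : traj) (k : 'I_N) : 'cV[R]_nw :=
  lc_resid S (xk v (cur k)) (uk v k) (wk v k).

Definition feasible (v : traj) : Prop :=
  xk v ord0 = xinit P /\
  forall k : 'I_N,
    xk v (nxt k) = lc_next S (xk v (cur k)) (uk v k) (wk v k) /\
    lcp_sol S (xk v (cur k)) (uk v k) (wk v k).

Definition alpha_set (v : traj) (k : 'I_N) : {set 'I_nw} :=
  [set i | (rk v k i 0 == 0) && (0 < wk v k i 0)]%SET.
Definition beta_set (v : traj) (k : 'I_N) : {set 'I_nw} :=
  [set i | (rk v k i 0 == 0) && (wk v k i 0 == 0)]%SET.
Definition gamma_set (v : traj) (k : 'I_N) : {set 'I_nw} :=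
  [set i | (0 < rk v k i 0) && (wk v k i 0 == 0)]%SET.

Definition grad_x (k : 'I_N) (x : 'cV[R]_nx) (u : 'cV[R]_nu) : 'cV[R]_nx :=
  grad (fun x' => stage P k x' u) x.
Definition grad_u (k : 'I_N) (x : 'cV[R]_nx) (u : 'cV[R]_nu) : 'cV[R]_nu :=
  grad (fun u' => stage P k x u') u.

(* [k.+1 = N] selects the last multiplier mu_(N-1), and [k = j.+1] makes mu_j the
   multiplier mu_(k-1); there is no condition in the direction of x_0, which is
   fixed. *)
Definition S_stationary (v : traj) : Prop :=
  feasible v /\
  exists (mu : 'I_N -> 'cV[R]_nx) (nul lam : 'I_N -> 'cV[R]_nw),
    [/\ forall k : 'I_N, k.+1 = N ->
          grad (terminal P) (xk v ord_max) + mu k = 0,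
        forall k j : 'I_N, k = j.+1 :> nat ->
          grad_x k (xk v (cur k)) (uk v k) + mu j
            - (Am S)^T *m mu k - (Ex S)^T *m nul k = 0,
        forall k : 'I_N,
          grad_u k (xk v (cur k)) (uk v k)
            - (Bu S)^T *m mu k - (Eu S)^T *m nul k = 0,
        forall k : 'I_N,
          - ((Bw S)^T *m mu k) - (Ew S)^T *m nul k - lam k = 0
      & forall k : 'I_N,
          [/\ forall i, i \in alpha_set v k -> lam k i 0 = 0,
              forall i, i \in gamma_set v k -> nul k i 0 = 0
            & forall i, i \in beta_set v k -> 0 <= nul k i 0 /\ 0 <= lam k i 0]].

Definition lin_resid (d : traj) (k : 'I_N) : 'cV[R]_nw :=
  Ew S *m wk d k + Ex S *m xk d (cur k) + Eu S *m uk d k.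

Definition mpec_critical_cone (v : traj) : set traj :=
  [set d |
    [/\ xk d ord0 = 0,
        forall k : 'I_N,
          xk d (nxt k) =
            Am S *m xk d (cur k) + Bu S *m uk d k + Bw S *m wk d k,
        forall k : 'I_N,
          [/\ forall i, i \in alpha_set v k -> lin_resid d k i 0 = 0,
              forall i, i \in gamma_set v k -> wk d k i 0 = 0
            & forall i, i \in beta_set v k ->
                [/\ 0 <= lin_resid d k i 0, 0 <= wk d k i 0
                  & lin_resid d k i 0 * wk d k i 0 = 0]]
      & ((grad cost v)^T *m d) 0 0 <= 0]].

(* The constraints are linear or complementarity constraints, so the Hessian of
   the MPEC Lagrangian is that of the cost. *)
Definition M_SSOSC (v : traj) : Prop :=
  forall d, mpec_critical_cone v d -> d <> 0 ->
    0 < (d^T *m hess cost v *m d) 0 0.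

(* The norm is the library's, i.e. the maximum norm of the stacked vector. *)
Definition isolated_local_minimizer (v : traj) : Prop :=
  exists2 eps : R, 0 < eps &
    forall v' : traj, feasible v' -> v' <> v -> `|v' - v| <= eps ->
      cost v < cost v'.

End OCP.

(* Main.v *)
(* The cost J is convex, and for a feasible v' close to vs the direction
   d = v' - vs satisfies all the linear and complementarity conditions of the
   critical cone exactly, not only to first order.  S-stationarity writes the
   derivative of J along d as a sum of products nu s + lambda dw that are
   nonnegative, so J(v') >= J(vs).  If equality held, J would be constant on the
   segment [vs, v'], hence both its slope and its second derivative along d
   would vanish, and d would be a critical direction violating M-SSOSC.

   If w solves the complementarity problems for (us, xs), then E_w, being
   positive semidefinite, annihilates w - ws, and (us, xs, w) is feasible by
   well-posedness.  The same argument applies to it, although it need not be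
   close to vs, and yields J(vs) < J(us, xs, w) unless w = ws; but J does not
   depend on w. *)
Require Import Defs.
From HB Require Import structures.
From mathcomp Require Import all_boot all_order all_algebra.
From mathcomp Require Import all_classical all_reals all_analysis.
From mathcomp Require Import ring lra.
Import Order.TTheory GRing.Theory Num.Theory.
Import numFieldNormedType.Exports.
Local Open Scope ring_scope.

(** * Continuity and differentiability of linear maps on matrices *)

Section LinearMaps.
Context {R : realType} {m n : nat} {V : normedModType R}.
Variable L : 'M[R]_(m, n) -> V.
Hypothesis L_lin : linear L.

Let linL : {linear 'M[R]_(m, n) -> V} :=
  HB.pack L (GRing.isLinear.Build _ _ _ _ L L_lin).

(** Expanding the argument over the [delta_mx] basis makes [L] a finite sum of coordinate functions
    with fixed vector weights. *)
Lemma mx_linear_continuous : continuous L.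
Proof.
have -> : L = \sum_i \sum_j (fun A : 'M[R]_(m, n) => A i j *: L (delta_mx i j)).
  apply/funext => A; rewrite fct_sumE.
  rewrite {1}[A]matrix_sum_delta -[LHS]/(linL _) linear_sum.
  apply: eq_bigr => i _; rewrite fct_sumE linear_sum; apply: eq_bigr => j _.
  by rewrite linearZ.
have sumC (I : finType) (F : I -> 'M[R]_(m, n) -> V) :
    (forall i, continuous (F i)) -> continuous (\sum_i F i).
  move=> Fc; elim/big_ind : _ => [x|f g fc gc x|i _]; last exact: Fc.
    exact: (@cst_continuous _ _ (0 : V)).
  exact: cvgD (fc x) (gc x).
apply: (sumC _ _) => i; apply: (sumC _ _) => j x.
exact: (@cvgZr_tmp _ _ _ _ _ _ _ _ (@coord_continuous R m n i j x)).
Qed.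

Lemma mx_linear_differentiable x : differentiable L x.
Proof. exact: (@linear_differentiable _ _ _ linL _ mx_linear_continuous). Qed.

Lemma mx_linear_diff x : 'd L x = L :> ('M[R]_(m, n) -> V).
Proof. exact: (@diff_lin _ _ _ linL _ mx_linear_continuous). Qed.

End LinearMaps.

(** * Convexity and second derivatives along a direction *)

Section SecondOrder.
Context {R : realType}.

Definition convex_fun {n : nat} (f : 'cV[R]_n -> R) : Prop :=
  forall x y t, 0 <= t <= 1 ->
    f (t *: x + (1 - t) *: y) <= t * f x + (1 - t) * f y.

Definition diff2 {n : nat} (f : 'cV[R]_n -> R) : Prop :=
  (forall x, differentiable f x) /\ (forall x, differentiable (grad f) x).

Lemma convex_functionW {n : nat} (f : 'cV[R]_n -> R) :
  convex_function setT f -> convex_fun f.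
Proof.
move=> cf x y t /andP[t0 t1].
exact: (cf (Itv01 t0 t1) x y (in_setT _) (in_setT _)).
Qed.

Lemma gradE {n : nat} (f : 'cV[R]_n -> R) x d : differentiable f x ->
  'D_d f x = ((grad f x)^T *m d) 0 0.
Proof.
move=> df; rewrite deriveE// {1}[d]matrix_sum_delta linear_sum mxE.
apply: eq_bigr => i _; rewrite big_ord1 linearZ/= !mxE deriveE//.
by rewrite mulrC.
Qed.

(** ['D_d f] is a combination of the partial derivatives with fixed weights [d j 0]; [gradE] applies
    to each of them. *)
Lemma hessE {n : nat} (f : 'cV[R]_n -> R) x d : diff2 f ->
  'D_d (fun z => 'D_d f z) x = (d^T *m hess f x *m d) 0 0.
Proof.
move=> [df dgf].
have dg z j : differentiable (fun z => 'D_(delta_mx j 0) f z) z.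
  rewrite (_ : (fun _ => _) = (fun A : 'cV[R]_n => A j 0) \o grad f); last first.
    by apply/funext => y /=; rewrite mxE.
  by apply: differentiable_comp => //; exact: differentiable_coord.
have -> : (fun z => 'D_d f z) =
    \sum_j (d j 0 *: (fun z => 'D_(delta_mx j 0) f z)).
  apply/funext => z; rewrite gradE// mxE fct_sumE.
  by apply: eq_bigr => j _; rewrite !mxE mulrC.
rewrite derive_sum; last first.
  by move=> j; apply/derivableZ/diff_derivable/dg.
rewrite mxE; apply: eq_bigr => j _.
rewrite deriveZ; last exact/diff_derivable/dg.
rewrite gradE; last exact: dg.
rewrite mulrC; congr (_ * _); rewrite !mxE; apply: eq_bigr => i _.
by rewrite !mxE mulrC.
Qed.

(** Convexity controls difference quotients for positive steps, so limits are taken from the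
    right. *)
Lemma cvg_derive_right {n : nat} (f : 'cV[R]_n -> R) x d :
  differentiable f x ->
  (h^-1 *: (f (h *: d + x) - f x) @[h --> 0^'+] --> 'D_d f x)%classic.
Proof.
move=> df; have cv := @diff_derivable _ _ _ _ _ d df.
apply: cvg_trans cv; apply: cvg_app => A [e e0 Ae].
by exists e => // t te t0; apply: Ae => //; rewrite gt_eqF.
Qed.

(** For a step [h] in (0, 1], convexity bounds the difference quotient by the chord slope from [x]
    to [x + d]; then [h] tends to 0. *)
Lemma tangent_le {n : nat} (f : 'cV[R]_n -> R) x d :
  convex_fun f -> differentiable f x -> 'D_d f x <= f (x + d) - f x.
Proof.
move=> cf df; have := cvg_derive_right f x d df.
move=> /cvgr_to_le; apply; near=> h.
have h0 : 0 < h by near: h; exact: nbhs_right_gt.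
have h1 : h <= 1 by near: h; exact: nbhs_right_le.
rewrite /= -[_ *: _]/(_ * _) ler_pdivrMl//.
have := cf (x + d) x h; rewrite (ltW h0) h1 => /(_ isT).
have -> : h *: (x + d) + (1 - h) *: x = h *: d + x.
  by rewrite scalerDr scalerBl scale1r addrC addrA subrK addrC.
lra.
Unshelve. all: by end_near. Qed.

(* The tangent inequality makes [f] constant on the segment from [x] to
   [x + d]; applied at interior points in the directions [d] and [- d], it kills
   the directional derivative there. *)
Lemma convex_flat {n : nat} (f : 'cV[R]_n -> R) x d :
    convex_fun f -> diff2 f -> 0 <= 'D_d f x -> f (x + d) <= f x ->
  'D_d f x = 0 /\ (d^T *m hess f x *m d) 0 0 = 0.
Proof.
move=> cf df2; have [df dgf] := df2; move=> D0 fle.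
have tan z s : s * 'D_d f z <= f (z + s *: d) - f z.
  have := tangent_le f z (s *: d) cf (df z).
  by rewrite deriveE// linearZ/= -deriveE.
have flat t : 0 <= t <= 1 -> f (x + t *: d) = f x.
  move=> t01; apply/eqP; rewrite eq_le; apply/andP; split.
    have := cf (x + d) x t t01.
    have -> : t *: (x + d) + (1 - t) *: x = x + t *: d.
      by rewrite scalerDr scalerBl scale1r addrC addrA subrK.
    by move: t01 => /andP[]; nra.
  by have := tan x t; move: t01 => /andP[]; nra.
have Dx0 : 'D_d f x = 0.
  apply/eqP; rewrite eq_le D0 andbT.
  by have := tan x 1; rewrite mul1r scale1r; lra.
split=> //; rewrite -hessE//.
have Dt t : 0 < t < 1 -> 'D_d f (t *: d + x) = 0.
  move=> /andP[t0 t1]; rewrite addrC.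
  (* The steps [1 - t] and [- t] lead to the endpoints [x + d] and [x], where [f] takes the same
     value; they bound the derivative from both sides. *)
  have := tan (x + t *: d) (1 - t); have := tan (x + t *: d) (- t).
  rewrite -!addrA -!scalerDl subrr subrKC scale0r addr0 scale1r.
  have := flat 1; rewrite scale1r ler01 lexx => /(_ isT) ->.
  rewrite flat ?(ltW t0) ?(ltW t1)// subrr => ? ?.
  by apply/eqP; rewrite eq_le; apply/andP; split; nra.
have dD : differentiable (fun z => 'D_d f z) x.
  have -> : (fun z => 'D_d f z) =
      (fun A : 'cV[R]_n => (A^T *m d) 0 0) \o grad f.
    by apply/funext => z /=; rewrite gradE.
  apply: differentiable_comp => //; apply: (@mx_linear_differentiable _ _ _ R^o).
  by move=> a A B; rewrite linearD linearZ/= mulmxDl -scalemxAl !mxE.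
(* The second derivative is the right limit of difference quotients of ['D_d f], which vanish for 0
   < [h] < 1. *)
apply: cvg_unique (cvg_derive_right _ _ _ dD) _ => //.
apply: (cvg_near_cst 0); near=> h.
rewrite /= Dx0 Dt ?subrr ?scaler0//; apply/andP; split.
  by near: h; exact: nbhs_right_gt.
by near: h; exact: nbhs_right_lt.
Unshelve. all: by end_near. Qed.

Section LinearComposition.
Context {m n : nat} (f : 'cV[R]_m -> R) {L : 'cV[R]_n -> 'cV[R]_m}.
Hypothesis L_lin : linear L.

Lemma derive_comp_linear x d : differentiable f (L x) ->
  'D_d (f \o L) x = 'D_(L d) f (L x).
Proof.
move=> df; have dL := mx_linear_differentiable L L_lin x.
rewrite deriveE; last exact: differentiable_comp.
by rewrite diff_comp//= (mx_linear_diff L) // deriveE.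
Qed.

Lemma convex_fun_comp_linear : convex_fun f -> convex_fun (f \o L).
Proof.
move=> cf x y t t01 /=.
pose linL : {linear 'cV[R]_n -> 'cV[R]_m} :=
  HB.pack L (GRing.isLinear.Build _ _ _ _ L L_lin).
by rewrite -[L]/(linL : _ -> _) linearD !linearZ; exact: cf.
Qed.

Lemma diff2_comp_linear : diff2 f -> diff2 (f \o L).
Proof.
move=> [df dgf]; split=> x.
  by apply: differentiable_comp => //; exact: mx_linear_differentiable.
(* [M] is the matrix of [L]; by the chain rule the gradient of [f \o L] is [M^T] times that of [f]
   at [L z]. *)
pose M : 'M[R]_(m, n) := \matrix_(i, j) L (delta_mx j 0) i 0.
have -> : grad (f \o L) = mulmx M^T \o (grad f \o L).
  apply/funext => z; apply/matrixP => i j; rewrite ord1 mxE derive_comp_linear//.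
  by rewrite gradE// !mxE; apply: eq_bigr => k _; rewrite !mxE mulrC.
apply: differentiable_comp.
  by apply: differentiable_comp => //; exact: mx_linear_differentiable.
by apply: mx_linear_differentiable => a A B; rewrite linearD linearZ.
Qed.

End LinearComposition.

Lemma convex_funD {n : nat} (f g : 'cV[R]_n -> R) :
  convex_fun f -> convex_fun g -> convex_fun (f + g).
Proof.
move=> cf cg x y t t01; have := cf x y t t01; have := cg x y t t01.
by rewrite !fctE /=; lra.
Qed.

Lemma diff2D {n : nat} (f g : 'cV[R]_n -> R) :
  diff2 f -> diff2 g -> diff2 (f + g).
Proof.
move=> [df dgf] [dg dgg]; split=> x; first exact: differentiableD.
have -> : grad (f + g) = grad f + grad g; last exact: differentiableD.
by apply/funext => z; apply/matrixP => i j; rewrite !mxE deriveD//;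
  exact: diff_derivable.
Qed.

Lemma convex_fun_sum {n N : nat} (F : 'I_N -> 'cV[R]_n -> R) :
  (forall k, convex_fun (F k)) -> convex_fun (\sum_k F k).
Proof.
move=> cF; elim/big_ind : _ => [x y t _|f g|k _]; last exact: cF.
  by rewrite -[0 (_ + _)]/0 -[0 x]/0 -[0 y]/0 !mulr0 addr0.
exact: convex_funD.
Qed.

Lemma diff2_sum {n N : nat} (F : 'I_N -> 'cV[R]_n -> R) :
  (forall k, diff2 (F k)) -> diff2 (\sum_k F k).
Proof.
move=> dF; elim/big_ind : _ => [|f g|k _]; last exact: dF.
  split=> x; first exact: differentiable_cst.
  have -> : grad (0 : 'cV[R]_n -> R) = cst 0; last exact: differentiable_cst.
  by apply/funext => z; apply/matrixP => i j; rewrite !mxE derive_cst.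
exact: diff2D.
Qed.

End SecondOrder.

(** * Complementarity problems with a positive semidefinite matrix *)

Section LinearComplementarity.
Context {R : realType}.

Lemma complementary_coord {n : nat} (a b : 'cV[R]_n) : complementary a b ->
  forall i, [/\ 0 <= a i 0, 0 <= b i 0 & a i 0 * b i 0 = 0].
Proof.
move=> [a0 ab b0] i; split=> //.
have := congr1 (fun A : 'M[R]_1 => A 0 0) ab; rewrite !mxE.
under eq_bigr do rewrite mxE.
move=> /psumr_eq0P -> // j _; exact: mulr_ge0.
Qed.

(** The quadratic form is the squared Euclidean norm of [V^T *m y], which must therefore vanish. *)
Lemma gram_mul_eq0 {n q : nat} (V : 'M[R]_(n, q)) (y : 'cV[R]_n) :
  (y^T *m (V *m V^T *m y)) 0 0 <= 0 -> V *m V^T *m y = 0.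
Proof.
rewrite -mulmxA; have -> : y^T *m (V *m (V^T *m y)) = (V^T *m y)^T *m (V^T *m y).
  by rewrite trmx_mul trmxK !mulmxA.
set z := V^T *m y; rewrite mxE; under eq_bigr do rewrite mxE -expr2.
move=> z_le0; suff -> : z = 0 by rewrite mulmx0.
have /psumr_eq0P z_eq0 : \sum_j z j 0 ^+ 2 = 0.
  by apply/eqP; rewrite eq_le z_le0 sumr_ge0// => j _; exact: sqr_ge0.
apply/matrixP => j k; rewrite ord1 [RHS]mxE; apply/eqP; rewrite -sqrf_eq0.
by rewrite z_eq0// => l _; exact: sqr_ge0.
Qed.

Lemma rank_one_blocks_gram {nx nu nw : nat} (S : lcmodel R nx nu nw) bp :
  rank_one_blocks S bp -> exists q (V : 'M[R]_(nw, q)), Ew S = V *m V^T.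
Proof.
move=> [m [_ Em]]; have [g reordK gK] := reord_bij bp.
(* Column [i] of [F] is [m i] on block [i] and zero elsewhere; [rowsub g] restores the original
   order of rows. *)
pose F : 'M[R]_(_, nblk bp) := \mxcol_i (m i *m delta_mx 0 i).
exists (nblk bp), (rowsub g F).
have -> : Ew S = mxsub g g (mxsub (@reord nw bp) (@reord nw bp) (Ew S)).
  by apply/matrixP => a b; rewrite !mxE !gK.
rewrite Em; have -> : \mxdiag_i (m i *m (m i)^T) = F *m F^T.
  rewrite tr_mxcol mul_mxcol_mxrow; apply: eq_mxblock => i j.
  rewrite trmx_mul trmx_delta mulmxA -(mulmxA (m i)) mul_delta_mx_cond.
  have [<-|_] := eqVneq i j; last by rewrite mulr0n mulmx0 mul0mx.
  have -> : delta_mx 0 0 = 1%:M :> 'M[R]_1.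
    by apply/matrixP => a b; rewrite !ord1 !mxE.
  by rewrite conform_mx_id mulr1n mulmx1.
by rewrite mxsub_mul; congr (_ *m _); apply/matrixP => a b; rewrite !mxE.
Qed.

(* Monotonicity: [Ew] is positive semidefinite, and complementarity makes
   [(w1 - w2)^T Ew (w1 - w2)] nonpositive. *)
Lemma lcp_sol_Ew {nx nu nw : nat} (S : lcmodel R nx nu nw) bp x u w1 w2 :
  rank_one_blocks S bp -> lcp_sol S x u w1 -> lcp_sol S x u w2 ->
  Ew S *m (w1 - w2) = 0.
Proof.
move=> /rank_one_blocks_gram[q [V EV]] /complementary_coord s1
  /complementary_coord s2.
have Er : Ew S *m (w1 - w2) = lc_resid S x u w1 - lc_resid S x u w2.
  by rewrite mulmxBr; apply/matrixP => i j; rewrite /lc_resid !mxE; ring.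
move: Er s1 s2; rewrite EV.
move: (lc_resid S x u w1) (lc_resid S x u w2) => r1 r2 Er s1 s2.
apply: gram_mul_eq0; rewrite Er mxE; apply: sumr_le0 => i _; rewrite !mxE.
have [r1_ge0 w1_ge0 rw1] := s1 i; have [r2_ge0 w2_ge0 rw2] := s2 i.
have -> : (w1 i 0 - w2 i 0) * (r1 i 0 - r2 i 0) =
    - (w1 i 0 * r2 i 0 + w2 i 0 * r1 i 0) by ring: rw1 rw2.
by rewrite oppr_le0 addr_ge0// mulr_ge0.
Qed.

End LinearComplementarity.

(** * The cost along differences of feasible trajectories *)

Section OptimalControl.
Context {R : realType} {nx nu nw N : nat}.
Variable P : ocp R nx nu nw N.
Local Notation S := (model P).
Local Notation traj := (traj R nx nu nw N).

Lemma uk_linear k : linear (fun v : traj => uk v k).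
Proof. by move=> a v w; apply/matrixP => i j; rewrite !mxE. Qed.

Lemma xk_linear k : linear (fun v : traj => xk v k).
Proof. by move=> a v w; apply/matrixP => i j; rewrite !mxE. Qed.

Lemma wk_linear k : linear (fun v : traj => wk v k).
Proof. by move=> a v w; apply/matrixP => i j; rewrite !mxE. Qed.

Lemma lin_resid_linear k : linear (fun v : traj => lin_resid P v k).
Proof.
move=> a v w; rewrite /lin_resid uk_linear xk_linear wk_linear.
rewrite !mulmxDr -!scalemxAr; apply/matrixP => i j; rewrite !mxE; ring.
Qed.

Lemma rkE v k : rk P v k = lin_resid P v k + ev S.
Proof. by []. Qed.

Let stage_arg k (v : traj) : 'cV[R]_(nx + nu) := col_mx (xk v (cur k)) (uk v k).

Let stage_arg_linear k : linear (stage_arg k).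
Proof.
move=> a v w; rewrite /stage_arg uk_linear xk_linear.
by rewrite -add_col_mx -scale_col_mx.
Qed.

(** In this form convexity, differentiability and derivatives of the cost follow from sum and
    composition rules. *)
Lemma costE : cost P = terminal P \o (fun v : traj => xk v ord_max) +
  \sum_k (stage_joint P k \o stage_arg k).
Proof.
apply/funext => v; rewrite /cost fctE fct_sumE /=; congr (_ + _).
by apply: eq_bigr => k _; rewrite /= /stage_joint col_mxKu col_mxKd.
Qed.

Lemma convex_cost : convex_costs P -> convex_fun (cost P).
Proof.
move=> [cT cS]; rewrite costE; apply: convex_funD.
  by apply: convex_fun_comp_linear; [exact: xk_linear|exact: convex_functionW].
apply: convex_fun_sum => k.
by apply: convex_fun_comp_linear => //; exact: convex_functionW.
Qed.

Lemma diff2_cost : C2_costs P -> diff2 (cost P).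
Proof.
move=> [[dT dgT _] dS]; rewrite costE; apply: diff2D.
  by apply: diff2_comp_linear; [exact: xk_linear|].
apply: diff2_sum => k; apply: diff2_comp_linear => //.
by have [? ? _] := dS k.
Qed.

(** Links the joint regularity of the stage costs to the partial gradients of S-stationarity: a
    coordinate direction moves only one of the two blocks. *)
Lemma grad_stage_joint k x u :
  grad (stage_joint P k) (col_mx x u) = col_mx (grad_x P k x u) (grad_u P k x u).
Proof.
rewrite -[LHS]vsubmxK; congr col_mx; apply/matrixP => i j; rewrite !mxE.
  rewrite delta_mx_ushift /derive; do 3 f_equal; apply/funext => h /=.
  rewrite scale_col_mx scaler0 add_col_mx add0r /stage_joint.
  by rewrite !col_mxKu !col_mxKd.
rewrite delta_mx_dshift /derive; do 3 f_equal; apply/funext => h /=.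
rewrite scale_col_mx scaler0 add_col_mx add0r /stage_joint.
by rewrite !col_mxKu !col_mxKd.
Qed.

Lemma derive_cost (hC2 : C2_costs P) (v d : traj) :
  'D_d (cost P) v = ((grad (terminal P) (xk v ord_max))^T *m xk d ord_max) 0 0 +
    \sum_k (((grad_x P k (xk v (cur k)) (uk v k))^T *m xk d (cur k)) 0 0 +
            ((grad_u P k (xk v (cur k)) (uk v k))^T *m uk d k) 0 0).
Proof.
have [[dT _ _] dS] := hC2.
have dJ k z : differentiable (stage_joint P k) z by have [] := dS k.
have dL k : differentiable (stage_joint P k \o stage_arg k) v.
  by apply: differentiable_comp => //; exact: mx_linear_differentiable.
rewrite costE deriveD; last 2 first.
- apply/diff_derivable/differentiable_comp => //.
  by apply: mx_linear_differentiable; exact: xk_linear.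
- by apply: derivable_sum => k; exact: diff_derivable.
rewrite derive_comp_linear//; last exact: xk_linear.
rewrite gradE//; congr (_ + _).
rewrite derive_sum; last by move=> k; exact: diff_derivable.
apply: eq_bigr => k _; rewrite derive_comp_linear// gradE// grad_stage_joint.
by rewrite tr_col_mx mul_row_col mxE.
Qed.

Local Notation dot a b := ((a^T *m b) 0 0).

Definition linear_dynamics (d : traj) : Prop :=
  xk d ord0 = 0 /\ forall k : 'I_N, xk d (nxt k) =
    Am S *m xk d (cur k) + Bu S *m uk d k + Bw S *m wk d k.

(** Pairing each stationarity equation with the matching component of [d] cancels the [mu]-terms
    through the linear dynamics and leaves only the complementarity multipliers. *)
Lemma derive_cost_multipliers (hN : (0 < N)%N) (hC2 : C2_costs P) (v d : traj)
    (mu : 'I_N -> 'cV[R]_nx) (nul lam : 'I_N -> 'cV[R]_nw) :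
    linear_dynamics d ->
    (forall k : 'I_N, k.+1 = N ->
       grad (terminal P) (xk v ord_max) + mu k = 0) ->
    (forall k j : 'I_N, k = j.+1 :> nat ->
       grad_x P k (xk v (cur k)) (uk v k) + mu j
         - (Am S)^T *m mu k - (Ex S)^T *m nul k = 0) ->
    (forall k : 'I_N,
       grad_u P k (xk v (cur k)) (uk v k)
         - (Bu S)^T *m mu k - (Eu S)^T *m nul k = 0) ->
    (forall k : 'I_N,
       - ((Bw S)^T *m mu k) - (Ew S)^T *m nul k - lam k = 0) ->
  'D_d (cost P) v =
    \sum_k (dot (nul k) (lin_resid P d k) + dot (lam k) (wk d k)).
Proof.
have dotDl n (a b c : 'cV[R]_n) : dot (a + b) c = dot a c + dot b c.
  by rewrite linearD mulmxDl mxE.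
have dotNl n (a c : 'cV[R]_n) : dot (- a) c = - dot a c.
  by rewrite linearN mulNmx mxE.
have dotDr n (a b c : 'cV[R]_n) : dot c (a + b) = dot c a + dot c b.
  by rewrite mulmxDr mxE.
have dot_tr m n (A : 'M[R]_(m, n)) a c : dot (A^T *m a) c = dot a (A *m c).
  by rewrite trmx_mul trmxK mulmxA.
have dot0l n (c : 'cV[R]_n) : dot 0 c = 0 by rewrite trmx0 mul0mx mxE.
have dot0r n (c : 'cV[R]_n) : dot c 0 = 0 by rewrite mulmx0 mxE.
move=> [d0 dS] hT hx hu hw; rewrite derive_cost//.
(* [T i] is the costate term of [x_i], so that the two sums of [mu]-terms
   telescope. *)
pose T (i : 'I_N.+1) :=
  if unlift ord0 i is Some j then dot (mu j) (xk d i) else 0.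
have -> : dot (grad (terminal P) (xk v ord_max)) (xk d ord_max) = - T ord_max.
  (* [hN] rules out [ord_max = ord0], so the final state carries a multiplier. *)
  rewrite /T; case: unliftP => [j ej|]; last first.
    by move=> /(congr1 val)/= N0; rewrite N0 in hN.
  have jN : j.+1 = N by have /(congr1 val) := ej.
  have /(congr1 (fun a => dot a (xk d ord_max))) := hT j jN.
  by rewrite dotDl dot0l => /eqP; rewrite addr_eq0 => /eqP.
have gx (k : 'I_N) : dot (grad_x P k (xk v (cur k)) (uk v k)) (xk d (cur k)) =
    - T (cur k) + dot (mu k) (Am S *m xk d (cur k))
    + dot (nul k) (Ex S *m xk d (cur k)).
  (* No stationarity condition exists at [x_0], but all terms vanish there because
     [xk d ord0 = 0]. *)
  rewrite /T; case: unliftP => [j ej|e0]; last first.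
    by rewrite e0 d0 !mulmx0 !mxE; ring.
  have kj : k = j.+1 :> nat by have /(congr1 val) := ej.
  have /(congr1 (fun a => dot a (xk d (cur k)))) := hx k j kj.
  by rewrite dot0l !dotDl !dotNl !dot_tr; lra.
have gu (k : 'I_N) : dot (grad_u P k (xk v (cur k)) (uk v k)) (uk d k) =
    dot (mu k) (Bu S *m uk d k) + dot (nul k) (Eu S *m uk d k).
  have /(congr1 (fun a => dot a (uk d k))) := hu k.
  by rewrite dot0l !dotDl !dotNl !dot_tr; lra.
have -> : \sum_k (dot (grad_x P k (xk v (cur k)) (uk v k)) (xk d (cur k)) +
            dot (grad_u P k (xk v (cur k)) (uk v k)) (uk d k)) =
    \sum_k (T (nxt k) - T (cur k)) +
    \sum_k (dot (nul k) (lin_resid P d k) + dot (lam k) (wk d k)).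
  rewrite -big_split; apply: eq_bigr => k _ /=.
  have -> : T (nxt k) = dot (mu k) (xk d (nxt k)) by rewrite /T liftK.
  rewrite gx gu dS /lin_resid !dotDr.
  have /(congr1 (fun a => dot a (wk d k))) := hw k.
  by rewrite dot0l !dotDl !dotNl !dot_tr; lra.
rewrite sumrB addrA; suff : \sum_k T (nxt k) = \sum_k T (cur k) + T ord_max.
  by move=> ->; ring.
(* The full sum of [T] is split off at its last index, then at its first, where [T] is 0. *)
have <- : \sum_i T i = \sum_k T (cur k) + T ord_max by rewrite big_ord_recr.
by rewrite big_ord_recl {2}/T unlift_none add0r.
Qed.

Lemma feasible_linear_dynamics v v' : feasible P v -> feasible P v' ->
  linear_dynamics (v' - v).
Proof.
have uB k : uk (v' - v) k = uk v' k - uk v k.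
  by apply/matrixP => i j; rewrite !mxE.
have xB k : xk (v' - v) k = xk v' k - xk v k.
  by apply/matrixP => i j; rewrite !mxE.
have wB k : wk (v' - v) k = wk v' k - wk v k.
  by apply/matrixP => i j; rewrite !mxE.
move=> [x0 xS] [x0' xS']; split; first by rewrite xB x0 x0' subrr.
move=> k; rewrite !xB uB wB (xS' k).1 (xS k).1 /lc_next !mulmxBr.
by apply/matrixP => i j; rewrite !mxE; ring.
Qed.

(* The last hypothesis makes [v' - v] satisfy the linearized complementarity
   constraints exactly; it holds for [v'] close to [v], and for [v'] differing
   from [v] only in [w]. *)
Lemma stationary_cost_lt (hN : (0 < N)%N) (hconvex : convex_costs P)
    (hC2 : C2_costs P) (v v' : traj) :
    S_stationary P v -> M_SSOSC P v -> feasible P v' -> v' <> v ->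
    (forall k i, (0 < wk v k i 0 -> rk P v' k i 0 = 0) /\
                 (0 < rk P v k i 0 -> wk v' k i 0 = 0)) ->
  cost P v < cost P v'.
Proof.
move=> [fv [mu [nul [lam [hT hx hu hw sgn]]]]] ssosc fv' ne act.
have [d0 dS] := feasible_linear_dynamics _ _ fv fv'; set d := v' - v in d0 dS *.
have sE k i : lin_resid P d k i 0 = rk P v' k i 0 - rk P v k i 0.
  have -> : lin_resid P d k = lin_resid P v' k - lin_resid P v k.
    by rewrite /d -scaleN1r addrC lin_resid_linear scaleN1r addrC.
  rewrite !rkE; move: (lin_resid P v' k) (lin_resid P v k) => a b.
  by rewrite !mxE; ring.
have wE k i : wk d k i 0 = wk v' k i 0 - wk v k i 0 by rewrite !mxE.
have sol k := complementary_coord _ _ (fv.2 k).2.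
have sol' k := complementary_coord _ _ (fv'.2 k).2.
have alphaP k i : i \in alpha_set P v k -> lin_resid P d k i 0 = 0.
  rewrite inE => /andP[/eqP r0 w0]; rewrite sE r0 subr0.
  exact: (act k i).1.
have gammaP k i : i \in gamma_set P v k -> wk d k i 0 = 0.
  rewrite inE => /andP[r0 /eqP w0]; rewrite wE w0 subr0.
  exact: (act k i).2.
(* On [beta_set] the components of [v] are zero, so the cone condition is the complementarity of
   [v'] itself. *)
have betaP k i : i \in beta_set P v k ->
    [/\ 0 <= lin_resid P d k i 0, 0 <= wk d k i 0
      & lin_resid P d k i 0 * wk d k i 0 = 0].
  rewrite inE => /andP[/eqP r0 /eqP w0]; rewrite sE wE r0 w0 !subr0.
  exact: sol'.
have D_ge0 : 0 <= 'D_d (cost P) v.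
  rewrite (derive_cost_multipliers hN hC2 _ _ _ _ _ (conj d0 dS) hT hx hu hw).
  apply: sumr_ge0 => k _; have [sgn_a sgn_c sgn_b] := sgn k.
  (* The three index sets cover all [i]: both products vanish on [alpha_set] and [gamma_set], and on
     [beta_set] all factors are nonnegative. *)
  have term i : 0 <= nul k i 0 * lin_resid P d k i 0 + lam k i 0 * wk d k i 0.
    have [r_ge0 w_ge0 rw0] := sol k i.
    have [w_gt0|w_le0] := ltP 0 (wk v k i 0).
      have ia : i \in alpha_set P v k.
        rewrite inE w_gt0 andbT; move/eqP: rw0.
        by rewrite mulf_eq0 (gt_eqF w_gt0) orbF.
      by rewrite alphaP// sgn_a// mulr0 mul0r addr0.
    have w0 : wk v k i 0 = 0 by apply/eqP; rewrite eq_le w_le0.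
    have [r_gt0|r_le0] := ltP 0 (rk P v k i 0).
      have ic : i \in gamma_set P v k by rewrite inE r_gt0 w0 eqxx.
      by rewrite gammaP// sgn_c// mulr0 mul0r addr0.
    have ib : i \in beta_set P v k by rewrite inE eq_le r_le0 r_ge0 w0 eqxx.
    have [nul_ge0 lam_ge0] := sgn_b i ib; have [s_ge0 dw_ge0 _] := betaP k i ib.
    by rewrite addr_ge0// mulr_ge0.
  move: (lin_resid P d k) (wk d k) term => s w term.
  rewrite !mxE -big_split; apply: sumr_ge0 => i _; rewrite /= !mxE; exact: term.
rewrite ltNge; apply/negP => le_cost.
have [] := convex_flat (cost P) v d (convex_cost hconvex) (diff2_cost hC2) D_ge0.
  by rewrite /d subrKC.
move=> D0 H0; suff : 0 < (d^T *m hess (cost P) v *m d) 0 0 by rewrite H0 ltxx.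
apply: ssosc; last by move=> /eqP; rewrite subr_eq0 => /eqP.
split=> //; first by move=> k; split; [exact: alphaP|exact: gammaP|exact: betaP].
by rewrite -gradE ?D0//; exact: (diff2_cost hC2).1.
Qed.

(** Components are affine, hence continuous, and finitely many pairs [k], [i] share one
    neighbourhood. *)
Lemma near_active (v : traj) : (\forall v' \near v, forall k i,
  (0 < wk v k i 0 -> 0 < wk v' k i 0) /\
  (0 < rk P v k i 0 -> 0 < rk P v' k i 0))%classic.
Proof.
have near_gt0 (f : traj -> 'cV[R]_nw) (c : 'cV[R]_nw) i :
    linear f -> 0 < (f v + c) i 0 ->
    (\forall v' \near v, 0 < (f v' + c) i 0)%classic.
  move=> f_lin f_gt0.
  have fc : {for v, continuous (fun v' => (f v' + c) i 0)}.
    apply: (continuous_comp (f := fun v' => f v' + c) (g := fun A => A i 0)).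
      exact: (cvgD (mx_linear_continuous f f_lin v) (cvg_cst c)).
    exact: coord_continuous.
  exact: (cvgr_gt _ fc _ f_gt0).
refine (@filter_forall _ _ _ _ (nbhs_filter v) _) => k.
refine (@filter_forall _ _ _ _ (nbhs_filter v) _) => i; apply: filterI.
  have [w_gt0|w_le0] := ltP 0 (wk v k i 0); last by near=> v'.
  have := near_gt0 _ 0 i (wk_linear k); rewrite addr0 => /(_ w_gt0).
  by apply: filterS => v' /=; rewrite addr0.
have [r_gt0|r_le0] := ltP 0 (rk P v k i 0); last by near=> v'.
have := near_gt0 _ (ev S) i (lin_resid_linear k) r_gt0.
by apply: filterS.
Unshelve. all: by end_near. Qed.

End OptimalControl.

(** * Isolated minimality and uniqueness of the complementarity trajectory *)

Theorem theorem3 (R : realType) (nx nu nw N : nat) (hN : (0 < N)%N)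
    (P : ocp R nx nu nw N)
    (hS : standing_assumptions (model P))
    (hconvex : convex_costs P) (hC2 : C2_costs P)
    (vs : traj R nx nu nw N)
    (hstat : S_stationary P vs) (hssosc : M_SSOSC P vs) :
  isolated_local_minimizer P vs /\
  (forall w : 'I_N -> 'cV[R]_nw,
     (forall k : 'I_N, lcp_sol (model P) (xk vs (cur k)) (uk vs k) (w k)) <->
     (forall k : 'I_N, w k = wk vs k)).
Proof.
have fvs := hstat.1; split.
  have /nbhs_ballP[e /= e0 He] := near_active P vs.
  (* Halving passes from the open ball to the non-strict bound on the norm. *)
  exists (e / 2); first by rewrite divr_gt0.
  move=> v fv ne ve; apply: (stationary_cost_lt P) => // k i.
  have /He/(_ k i)[wpos rpos] : ball vs e v.
    by rewrite -ball_normE /= distrC (le_lt_trans ve)//; lra.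
  have [_ _ rw] := complementary_coord _ _ (fv.2 k).2 i.
  (* A component that stays positive at [v] forces its complementary partner to vanish. *)
  move/eqP: rw; rewrite mulf_eq0 => /orP rw; split.
    by move=> /wpos; case: rw => /eqP // ->; rewrite ltxx.
  by move=> /rpos; case: rw => /eqP // e1; rewrite /rk e1 ltxx.
move=> w; split=> [solw|ew k]; last by rewrite ew; exact: (fvs.2 k).2.
have [wp [bp [r1 _]]] := hS.
pose v : traj R nx nu nw N := col_mx (usubmx vs) (\mxcol_k w k).
have uv k : uk v k = uk vs k by rewrite /uk col_mxKu.
have xv k : xk v k = xk vs k by rewrite /xk col_mxKu.
have wv k : wk v k = w k by rewrite /wk col_mxKd mxcolK.
have [vvs|/eqP ne] := eqVneq v vs; first by move=> k; rewrite -wv vvs.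
have fv : feasible P v.
  split=> [|k]; first by rewrite xv fvs.1.
  have [xS sol] := fvs.2 k.
  by rewrite !xv uv wv; split=> //; rewrite xS; exact: wp.
have rv k : rk P v k = rk P vs k.
  rewrite /rk /lc_resid xv uv wv; congr (_ + _ + _ + _); apply/eqP.
  rewrite -subr_eq0 -mulmxBr; apply/eqP.
  exact: lcp_sol_Ew r1 (solw k) (fvs.2 k).2.
suff : cost P vs < cost P v.
  rewrite /cost xv; under [X in _ < _ + X]eq_bigr do rewrite xv uv.
  by rewrite ltxx.
apply: (stationary_cost_lt P) => // k i.
(* Equal residuals replace closeness: complementarity of [vs] gives the first implication, that of
   [v] the second. *)
have [_ _ rw] := complementary_coord _ _ (fvs.2 k).2 i.
have [_ _ rw'] := complementary_coord _ _ (fv.2 k).2 i.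
split=> h.
  by rewrite rv; move/eqP: rw; rewrite mulf_eq0 (gt_eqF h) orbF => /eqP.
by move/eqP: rw'; rewrite -/(rk P v k) rv mulf_eq0 (gt_eqF h) => /eqP.
Qed.
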